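(* Let $a,b\in\mathbb{R}$, let $f:\mathbb{N}_a\cap{_{b}\mathbb{N}}\to\mathbb{R}$ be a function and let $f^*:\mathbb{N}_{-b}\cap{_{-a}\mathbb{N}}\to\mathbb{R}$, $f^*(t)=f(-t)$, be its symmetric dual. Let $\alpha>0$. Then for every $t\in\mathbb{N}_{a+1}\cap{_{b}\mathbb{N}}$, $$(\nabla_a^{-\alpha}f)(t)=({_{-a}\nabla^{-\alpha}}f^* )(-t),$$ where the right-hand side is the nabla right fractional sum of $f^*$ ending at $-a$, evaluated at $-t$.
   Context: For real $a,b$: $\mathbb{N}_a=\{a,a+1,a+2,\ldots\}$ and ${_{b}\mathbb{N}}=\{b,b-1,b-2,\ldots\}$. Jump operators: $\sigma(t)=t+1$, $\rho(t)=t-1$. Rising function: $t^{\overline{\alpha}}=\Gamma(t+\alpha)/\Gamma(t)$ for real $\alpha$ and $t\in\mathbb{R}\setminus\{\ldots,-2,-1,0\}$, with $0^{\overline{\alpha}}=0$. For $\alpha>0$, the nabla left fractional sum starting from $a$ is $$\nabla_a^{-\alpha}f(t)=\frac{1}{\Gamma(\alpha)}\sum_{s=a+1}^{t}(t-\rho(s))^{\overline{\alpha-1}}f(s),\quad t\in\mathbb{N}_{a+1},$$ and the nabla right fractional sum ending at $b$ is $${_{b}\nabla^{-\alpha}}f(t)=\frac{1}{\Gamma(\alpha)}\sum_{s=t}^{b-1}(s-\rho(t))^{\overline{\alpha-1}}f(s),\quad t\in{_{b-1}\mathbb{N}}.$$ For functions defined only on a finite set of points these are considered at those $t$ for which all values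 of the function occurring are defined. *)

(* Defs.v *)
From HB Require Import structures.
From mathcomp Require Import all_boot all_order all_algebra.
From mathcomp Require Import all_classical all_reals all_analysis.
Import Order.TTheory GRing.Theory Num.Theory.
Import numFieldNormedType.Exports.

Set Implicit Arguments.
Unset Strict Implicit.
Unset Printing Implicit Defensive.

Local Open Scope classical_set_scope.
Local Open Scope ring_scope.

Definition upN {R : realType} (a : R) : set R := range (fun k : nat => a + k%:R).

Definition downN {R : realType} (b : R) : set R :=
  range (fun k : nat => b - k%:R).

Definition rho {R : realType} (t : R) : R := t - 1.

(* Converges for 0 < x only. *)
Definition Gamma_int {R : realType} (x : R) : R :=
  \int[lebesgue_measure]_(u in `]0, +oo[) (u `^ (x - 1) * expR (- u)).

(* Gamma on R \ {..., -2, -1, 0}, extended from the half-line 0 < x by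
   Gamma x = Gamma (x + n) / (x (x + 1) ... (x + n - 1)), where n is least
   with 0 < x + n.  The value at a pole is 0. *)
Definition Gamma {R : realType} (x : R) : R :=
  let n := if 0 < x then 0%N else (Num.truncn (- x)).+1 in
  Gamma_int (x + n%:R) / \prod_(i < n) (x + i%:R).

(* Meaningful for t outside {..., -2, -1} only. *)
Definition rising {R : realType} (t alpha : R) : R :=
  if t == 0 then 0 else Gamma (t + alpha) / Gamma t.

(* Functions on a set of reals are represented by total functions of which only
   the values on that set are relevant.  A sum over s = p, p + 1, ..., q is a sum
   over the finite set upN p `&` downN q. *)

Definition nabla_left_sum {R : realType} (alpha a : R) (f : R -> R) (t : R) : R :=
  (Gamma alpha)^-1 *
  \sum_(s \in upN (a + 1) `&` downN t) (rising (t - rho s) (alpha - 1) * f s).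

Definition nabla_right_sum {R : realType} (alpha b : R) (f : R -> R) (t : R) : R :=
  (Gamma alpha)^-1 *
  \sum_(s \in upN t `&` downN (b - 1)) (rising (s - rho t) (alpha - 1) * f s).

(* fs is constrained on its domain only, so nothing is known about its values
   elsewhere. *)
Definition symmetric_dual {R : realType} (a b : R) (f fs : R -> R) : Prop :=
  forall t : R, (upN (- b) `&` downN (- a)) t -> fs t = f (- t).

(* Main.v *)
Require Import Defs.
From mathcomp Require Import all_boot all_order all_algebra.
From mathcomp Require Import all_classical all_reals all_analysis.
Import Order.TTheory GRing.Theory Num.Theory.
Local Open Scope classical_set_scope.
Local Open Scope ring_scope.

(** Negation swaps upward and downward chains ([upN_opp], [downN_opp]), so it maps the range of the
    left sum bijectively onto that of the right sum. Under this reindexing the sums agree term by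
    term. *)

Lemma upN_opp {R : realType} {a x : R} : upN (- a) (- x) <-> downN a x.
Proof.
split=> -[k _ e]; exists k => //; last by rewrite -e opprB addrC.
by rewrite -[RHS]opprK -e opprD opprK.
Qed.

Lemma downN_opp {R : realType} {a x : R} : downN (- a) (- x) <-> upN a x.
Proof. by rewrite -upN_opp !opprK. Qed.

(** Lets bounds from above be chained by [upN_trans]. *)
Lemma downN_upN {R : realType} {x y : R} : downN y x <-> upN x y.
Proof. by split=> -[k _ <-]; exists k; rewrite // ?addrK ?subrK. Qed.

Lemma upN_trans {R : realType} {a x y : R} : upN a x -> upN x y -> upN a y.
Proof.
by move=> [j _ <-] [k _ <-]; exists (j + k)%N; rewrite // natrD addrA.
Qed.

Lemma upN_succ {R : realType} (a : R) : upN a (a + 1).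
Proof. by exists 1%N. Qed.

Theorem theorem20 (R : realType) (a b : R) (f fs : R -> R)
  (hfs : symmetric_dual a b f fs) (alpha : R) (halpha : 0 < alpha) (t : R)
  (ht : (upN (a + 1) `&` downN b) t) :
  nabla_left_sum alpha a f t = nabla_right_sum alpha (- a) fs (- t).
Proof.
case: ht => _ /downN_upN tb; rewrite /nabla_left_sum /nabla_right_sum.
have opp_bij : set_bij (upN (a + 1) `&` downN t)
    (upN (- t) `&` downN (- a - 1)) -%R.
  (* Writing [- a - 1] as [- (a + 1)] exposes it as a negated endpoint. *)
  rewrite -opprD; split.
  - by move=> s [sa st]; split; [apply/upN_opp | apply/downN_opp].
  - by move=> x y _ _ /oppr_inj.
  - move=> s; rewrite -(opprK s) => -[/upN_opp st /downN_opp sa].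
    by exists (- s).
congr (_ * _); rewrite (reindex_fsbig _ _ _ _ opp_bij); apply: eq_fsbigr => s.
(* [fs] is known only on its domain; [- s] lies there because integer steps lead from [a] through
   [a + 1], [s] and [t] to [b]. *)
rewrite inE => -[sa /downN_upN st]; rewrite hfs ?opprK; last first.
  split; first exact/upN_opp/downN_upN/(upN_trans st tb).
  exact/downN_opp/(upN_trans (upN_succ a) sa).
(* Both rising functions have base [t - s + 1]. *)
by rewrite /rho !opprB opprK [- s + _]addrC [1 + t]addrC addrA.
Qed.
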